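(* No tournament on $9$ vertices is intrinsically $3$-linked as a directed graph.
   Context: A tournament on $n$ vertices is a directed graph on $n$ vertices with exactly one directed edge between each pair of distinct vertices (equivalently, the complete graph $K_n$ with a choice of orientation of each edge). Embeddings are embeddings of the graph in $S^3$, in the usual (tame) sense of spatial graph theory. A cycle in a directed graph means a cycle of the underlying undirected graph; it is consistently oriented if its edges all point the same way around the cycle (i.e. it is a directed cycle). A directed graph $G$ is intrinsically $n$-linked as a directed graph (digraph) if every embedding of $G$ in $S^3$ contains $n$ pairwise disjoint, consistently oriented cycles that form a non-split $n$-component link. *)

(* Defs.v *)
From mathcomp Require Import all_boot all_order all_algebra.
From mathcomp Require Import all_classical all_reals all_analysis.
Import numFieldNormedType.Exports.
Import Order.TTheory GRing.Theory Num.Theory.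

Set Implicit Arguments.
Unset Strict Implicit.
Unset Printing Implicit Defensive.

Local Open Scope classical_set_scope.
Local Open Scope ring_scope.

Definition tournament (V : finType) (e : rel V) : Prop :=
  irreflexive e /\ forall x y : V, x != y -> e x y (+) e y x.

(* Consistently oriented cycles only, listed in the direction of travel.  Those
   of length 1 (loops) and 2 (antiparallel pairs) do not occur in tournaments. *)
Definition directed_cycle (V : finType) (e : rel V) (c : seq V) : bool :=
  [&& (0 < size c)%N, uniq c & cycle e c].

Section S3.
Variable R : realType.

(* The 3-sphere, as R^3 with a point at infinity ([None]) added. *)
Definition S3 := one_point_compactification 'rV[R]_3.

Definition homeomorphism (h : S3 -> S3) : Prop :=
  continuous h /\
  exists g : S3 -> S3, [/\ continuous g, cancel h g & cancel g h].

Definition convex_hull (p : seq 'rV[R]_3) : set 'rV[R]_3 :=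
  [set x | exists w : 'I_(size p) -> R,
     [/\ forall i, 0 <= w i, \sum_i w i = 1 & x = \sum_i w i *: p`_i]].

(* A finite union of convex polytopes in R^3, of any dimensions. *)
Definition polyhedral (X : set S3) : Prop :=
  exists P : seq (seq 'rV[R]_3),
    X = [set Some x | x in \bigcup_(p in [set` P]) convex_hull p].

Definition tame (X : set S3) : Prop :=
  exists2 h : S3 -> S3, homeomorphism h & polyhedral (h @` X).

(* Written out because [`|x|] is the sup norm on ['rV_3]. *)
Definition unit_S2 : set 'rV[R]_3 := [set x | \sum_i x ord0 i ^+ 2 = 1].

Definition tame_2sphere (S : set S3) : Prop :=
  tame S /\
  exists f : 'rV[R]_3 -> S3,
    [/\ {within unit_S2, continuous f}, set_inj unit_S2 f & S = f @` unit_S2].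

Definition split_link (n : nat) (L : 'I_n -> set S3) : Prop :=
  exists S : set S3,
    [/\ tame_2sphere S,
        forall i, L i `&` S = set0
      & exists i j x y,
          [/\ L i x, L j y & ~ connected_component (~` S) x y]].

End S3.

(* [pos x] is the image of the vertex [x]; for [e x y], the restriction of
   [arc x y] to [0, 1] parametrizes the image of the edge from [x] to [y].
   The values of [arc x y] for other pairs, or off [0, 1], are irrelevant. *)
Record embedding (R : realType) (V : finType) (e : rel V) := Embedding {
  pos : V -> S3 R;
  arc : V -> V -> R -> S3 R;
  pos_inj : injective pos;
  arc_continuous : forall x y, e x y -> {within `[0, 1], continuous (arc x y)};
  arc_source : forall x y, e x y -> arc x y 0 = pos x;
  arc_target : forall x y, e x y -> arc x y 1 = pos y;
  arc_avoids_pos : forall x y z t, e x y -> t \in `]0, 1[ ->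
    arc x y t <> pos z;
  arc_inj : forall x y x' y' t t', e x y -> e x' y' ->
    t \in `]0, 1[ -> t' \in `]0, 1[ -> arc x y t = arc x' y' t' ->
    [/\ x = x', y = y' & t = t'];
  embedding_tame : tame
    (range pos `|`
     \bigcup_(p in [set p : V * V | e p.1 p.2]) (arc p.1 p.2 @` `[0, 1]))
}.

Definition cycle_image (R : realType) (V : finType) (e : rel V)
    (f : embedding R e) (c : seq V) : set (S3 R) :=
  \bigcup_(x in [set` c]) (arc f x (next c x) @` `[0, 1]).

Definition intrinsically_linked (R : realType) (n : nat) (V : finType)
    (e : rel V) : Prop :=
  forall f : embedding R e,
  exists c : 'I_n -> seq V,
    [/\ forall i, directed_cycle e (c i),
        forall i j x, i != j -> x \in c i -> x \notin c j
      & ~ split_link (fun i => cycle_image f (c i))].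

(* Main.v *)
(** A straight-line drawing suffices.  Nine explicit points of R^3 in general
    position, labelled 0..8, have the following property: for each of the 280
    partitions of the labels into three triples, either one of the triples is
    [{0, a, b}] with [a], [b] in [{1, 2, 3, 4}], or one of the three flat
    triangles is not pierced by an edge of the two others.  In the second case
    the link is split by the boundary of a thin tetrahedron around that
    triangle.  To rule out the first case, put label 0 on any vertex [x0]: of
    the 8 other vertices at least 4 are out-neighbours of [x0], or at least 4
    are in-neighbours; give these the labels 1..4, so that [{0, a, b}] is never
    a directed cycle.  Three disjoint directed cycles of a tournament on 9
    vertices are triangles partitioning the vertices, so nothing else occurs. *)

Require Import Defs.
From mathcomp Require Import all_boot all_order all_algebra.
From mathcomp Require Import all_classical all_reals all_analysis.
From mathcomp Require Import zify ring lra.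
Import numFieldNormedType.Exports.
Import Order.TTheory GRing.Theory Num.Theory.

Set Implicit Arguments.
Unset Strict Implicit.
Unset Printing Implicit Defensive.

Local Open Scope classical_set_scope.
Local Open Scope ring_scope.

Local Notation ix := (@Ordinal 3 0 isT).
Local Notation iy := (@Ordinal 3 1 isT).
Local Notation iz := (@Ordinal 3 2 isT).

(** Six times the signed volume of the tetrahedron [abcd]; over an arbitrary
    ring, so that it can be evaluated on integer points. *)
Definition vol (K : comNzRingType) (a b c d : 'I_3 -> K) : K :=
  let u i := b i - a i in let v i := c i - a i in let w i := d i - a i in
  u ix * (v iy * w iz - v iz * w iy) - u iy * (v ix * w iz - v iz * w ix)
    + u iz * (v ix * w iy - v iy * w ix).

(** * Convex hulls, tetrahedra and splitting spheres *)

Section Geometry.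
Variable R : realType.
Notation V3 := 'rV[R]_3.
Implicit Types a b c d p q x y : V3.

Definition rvol a b c d := vol (a ord0) (b ord0) (c ord0) (d ord0).

Lemma rowP3 x y : x ord0 ix = y ord0 ix -> x ord0 iy = y ord0 iy ->
  x ord0 iz = y ord0 iz -> x = y.
Proof.
move=> xy0 xy1 xy2; apply/rowP => -[[|[|[|//]]] i].
- by have -> : Ordinal i = ix by exact: val_inj.
- by have -> : Ordinal i = iy by exact: val_inj.
- by have -> : Ordinal i = iz by exact: val_inj.
Qed.

(** Cramer's rule cleared of denominators: a polynomial identity, valid for degenerate tetrahedra
    too. *)
Lemma rvol_combination a b c d p :
  rvol p b c d *: a + rvol a p c d *: b + rvol a b p d *: c + rvol a b c p *: d
  = rvol a b c d *: p.
Proof. by apply: rowP3; rewrite !mxE /rvol /vol; ring. Qed.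

Lemma rvol_sum a b c d p :
  rvol p b c d + rvol a p c d + rvol a b p d + rvol a b c p = rvol a b c d.
Proof. by rewrite /rvol /vol; ring. Qed.

Lemma rvol_affine a b c p q s t : s + t = 1 -> rvol a b c (s *: p + t *: q) =
  s * rvol a b c p + t * rvol a b c q.
Proof. by move/(canRL (addrK _)) => ->; rewrite /rvol /vol !mxE; ring. Qed.

Lemma rvol_swap34 a b c d : rvol a b d c = - rvol a b c d.
Proof. by rewrite /rvol /vol; ring. Qed.

Lemma rvol_continuous (T : topologicalType) (f g h k : T -> V3) :
  continuous f -> continuous g -> continuous h -> continuous k ->
  continuous (fun t => rvol (f t) (g t) (h t) (k t)).
Proof.
move=> fc gc hc kc t.
have co (e : T -> V3) i : continuous e -> continuous_at t (fun t => e t ord0 i).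
  by move=> ec; exact: (continuous_comp (ec t) (@coord_continuous _ _ _ _ _ _)).
have cB (e : T -> V3) i : continuous e ->
    continuous_at t (fun t => e t ord0 i - f t ord0 i).
  by move=> ec; exact: (continuousB (co _ _ ec) (co _ _ fc)).
have cM (e e' : T -> V3) i j : continuous e -> continuous e' -> continuous_at t
    (fun t => (e t ord0 i - f t ord0 i) * (e' t ord0 j - f t ord0 j)).
  by move=> ec ec'; exact: (continuousM (cB _ _ ec) (cB _ _ ec')).
have cD i j l : continuous_at t (fun t => (g t ord0 i - f t ord0 i) *
    ((h t ord0 j - f t ord0 j) * (k t ord0 l - f t ord0 l) -
     (h t ord0 l - f t ord0 l) * (k t ord0 j - f t ord0 j))).
  exact: (continuousM (cB _ _ gc) (continuousB (cM _ _ _ _ hc kc) (cM _ _ _ _ hc kc))).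
exact: (continuousD (continuousB (cD _ _ _) (cD _ _ _)) (cD _ _ _)).
Qed.

Lemma segment_continuous p q : continuous (fun t : R => (1 - t) *: p + t *: q).
Proof.
move=> t; exact: (continuousD
  (continuousZr_tmp (continuousB (@cst_continuous _ _ (1 : R) t) cvg_id))
  (continuousZr_tmp cvg_id)).
Qed.

(** [{g < 1}] is clopen in the complement of the sphere: it is open, and adding
    the sphere to it gives a set compact in R^3, hence closed in S^3. *)
Lemma level_sphere_separates (g : V3 -> R) (x y : V3) :
  continuous g -> compact [set p | g p <= 1] -> g x < 1 -> 1 < g y ->
  ~ connected_component (~` ((Some : V3 -> S3 R) @` [set p | g p = 1]))
      (Some x) (Some y).
Proof.
move=> gc Kc gx gy [C [/= Cx CS Ccon] Cy].
have Ko : open [set p | g p < 1] by apply: (open_comp _ (@open_lt _ 1)) => p _; apply: gc.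
have Kcl : closed [set p | g p <= 1].
  by apply: (closed_comp _ (@closed_le _ 1)) => p _; apply: gc.
pose U := (Some : V3 -> S3 R) @` [set p | g p < 1].
pose W := (Some : V3 -> S3 R) @` [set p | g p <= 1].
have Uo : open U by apply: one_point_compactification_open_some.
have Wc : closed W.
  rewrite -openC openE => -[p|] /= Wp; rewrite /interior /nbhs /=.
    apply: (@filterS _ _ _ (~` [set p | g p <= 1])).
      by move=> q /= Kq [q' Kq' [E]]; apply: Kq; rewrite -E.
    apply: open_nbhs_nbhs; split; first by rewrite openC.
    by move=> /= Kp; apply: Wp; exists p.
  (* At infinity the neighbourhoods contain complements of closed compact sets; this is where [Kc]
     enters. *)
  exists [set p | g p <= 1] => //.
  by move=> q [[q' Kq' <-] [q'' Kq'' [E]]|-> []//]; apply: Kq'; rewrite /= -E.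
have CUW : C `&` U = C `&` W.
  apply/seteqP; split=> [q [Cq [p /= pU E]]|q [Cq [p /= pW E]]]; split => //.
    by exists p => //=; apply: ltW.
  exists p => //=; rewrite lt_neqAle pW andbT; apply/eqP => gp.
  by apply: (CS _ Cq); exists p.
have CU : C `&` U = C.
  apply: Ccon; first by exists (Some x); split => //; exists x.
    by exists U.
  by exists W; rewrite // -CUW.
have [_ [p /= gp [E]]] : (C `&` U) (Some y) by rewrite CU.
by move: gp gy; rewrite E => /lt_trans/[apply]; rewrite ltxx.
Qed.

(** The sphere is the image of [unit_S2] under [x |-> c + x / rho x]. *)
Lemma gauge_sphere (rho : V3 -> R) (c : V3) :
  continuous rho ->
  (forall k x, 0 < k -> rho (k *: x) = k * rho x) ->
  (forall x, x != 0 -> 0 < rho x) ->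
  exists f : V3 -> S3 R,
    [/\ {within @unit_S2 R, continuous f}, set_inj (@unit_S2 R) f
      & Some @` [set p | rho (p - c) = 1] = f @` @unit_S2 R].
Proof.
move=> rc rh rp.
pose n2 (x : V3) := \sum_i x ord0 i ^+ 2.
have n2h k x : n2 (k *: x) = k ^+ 2 * n2 x.
  by rewrite /n2 mulr_sumr; apply: eq_bigr => i _; rewrite mxE exprMn.
have n2p x : x != 0 -> 0 < n2 x.
  move=> x0; rewrite lt_def sumr_ge0 ?andbT; last by move=> i _; apply: sqr_ge0.
  apply: contra x0 => /eqP; rewrite /n2 => xi; apply/eqP/rowP => i; rewrite mxE.
  have /(_ i isT)/eqP := psumr_eq0P (fun j _ => sqr_ge0 (x ord0 j)) xi.
  by rewrite sqrf_eq0 => /eqP.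
have S0 x : @unit_S2 R x -> x != 0.
  move=> Sx; apply/eqP => x0.
  have : n2 x = 0 by rewrite x0 -(scale0r 0) n2h expr2 !mul0r.
  by rewrite [n2 x]Sx => /eqP; rewrite oner_eq0.
exists (fun x => Some (c + (rho x)^-1 *: x)); split.
- move=> x; apply: continuous_in_subspaceT => {x} x /set_mem /S0 x0.
  have fx : continuous_at x (fun y => c + (rho y)^-1 *: y).
    exact: (cvgD (cvg_cst c) (cvgZ (cvgV (lt0r_neq0 (rp x x0)) (rc x)) cvg_id)).
  have sc : continuous (Some : V3 -> S3 R).
    exact: one_point_compactification_some_continuous.
  exact: (continuous_comp fx (sc _)).
(* Equal images make [x] a positive multiple of [y]; both have Euclidean norm 1, so the factor is
   1. *)
- move=> x y /set_mem Sx /set_mem Sy [/addrI E].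
  have [rx ry] := (rp _ (S0 _ Sx), rp _ (S0 _ Sy)).
  have xy : x = (rho x / rho y) *: y.
    by rewrite -scalerA -E scalerA divff ?gt_eqF // scale1r.
  have k0 : 0 < rho x / rho y by apply: divr_gt0.
  have := n2h (rho x / rho y) y; rewrite -xy /n2 Sx Sy mulr1.
  by move/esym/eqP; rewrite sqrp_eq1 ?(ltW k0) // => /eqP k1; rewrite xy k1 scale1r.
- apply/seteqP; split=> [_ [p /= rpc <-]|_ [x /= Sx <-]].
    (* Homogeneity with factor 2 forces [rho 0 = 0]. *)
    have pc : p - c != 0.
      apply/eqP => pc; move: rpc (rh 2%:R 0 (ltr0Sn _ _)); rewrite scaler0 pc => ->; lra.
    pose k := Num.sqrt (n2 (p - c)).
    have k0 : 0 < k by rewrite sqrtr_gt0 n2p.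
    exists (k^-1 *: (p - c)).
      change (n2 (k^-1 *: (p - c)) = 1).
      by rewrite n2h exprVn sqr_sqrtr ?mulVf ?gt_eqF ?n2p // ltW ?n2p.
    by rewrite rh ?invr_gt0 // rpc mulr1 invrK scalerA divff ?gt_eqF // scale1r addrC subrK.
  have rx := rp _ (S0 _ Sx).
  exists (c + (rho x)^-1 *: x) => //=.
  by rewrite addrAC subrr add0r rh ?invr_gt0 // mulVf ?gt_eqF.
Qed.

(** * Small convex hulls, barycentric coordinates and tetrahedra *)

Lemma convex_hull1 p : convex_hull [:: p] = [set p].
Proof.
apply/seteqP; split=> [x [w [_ w1 ->]]|_ ->] /=.
  by move: w1; rewrite !big_ord1 => ->; rewrite scale1r.
by exists (fun=> 1); rewrite !big_ord1 scale1r; split.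
Qed.

Lemma convex_hull2 p q :
  convex_hull [:: p; q] = (fun t : R => (1 - t) *: p + t *: q) @` `[0, 1].
Proof.
apply/seteqP; split=> [x [w [w0 w1 ->]]|_ [t /= + <-]] /=.
  move: w1; rewrite !big_ord_recl !big_ord0 !addr0 /= => w1.
  have := w0 ord0; have := w0 (lift ord0 ord0) => wp wq.
  exists (w (lift ord0 ord0)); last by rewrite -w1 addrK.
  by rewrite /= in_itv /= wp -w1 ler_wpDl.
rewrite in_itv /= => /andP[t0 t1].
exists (fun i => nth 0 [:: 1 - t; t] i).
rewrite !big_ord_recl !big_ord0 /= !addr0 subrK; split=> //.
by case=> [[|[|//]]] _ //=; rewrite subr_ge0.
Qed.

Lemma convex_hull3 a b c x : convex_hull [:: a; b; c] x <->
  exists s t u, [/\ 0 <= s, 0 <= t, 0 <= u, s + t + u = 1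
    & x = s *: a + t *: b + u *: c].
Proof.
split=> [[w [w0 w1 ->]]|[s [t [u [s0 t0 u0 s1 ->]]]]].
  move: w1; rewrite !big_ord_recl !big_ord0 !addr0 /= !addrA => w1.
  by do 3!eexists; split; [| | |exact: w1|].
exists (fun i => nth 0 [:: s; t; u] i).
rewrite !big_ord_recl !big_ord0 /= !addr0 !addrA; split=> //.
by case=> [[|[|[|//]]]].
Qed.

(** Barycentric coordinates of [p] with respect to [abcd], by Cramer's rule. *)
Definition bary a b c d p : seq R := [seq r / rvol a b c d |
  r <- [:: rvol p b c d; rvol a p c d; rvol a b p d; rvol a b c p]].

(** Dividing by the volume in [bary] makes these sign conditions independent of the orientation of
    [abcd]. *)
Definition tetrahedron a b c d : set V3 := [set p | all (>= 0) (bary a b c d p)].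
Definition open_tetrahedron a b c d : set V3 := [set p | all (> 0) (bary a b c d p)].

Lemma baryK a b c d p : rvol a b c d != 0 -> let r := nth 0 (bary a b c d p) in
  r 0%N + r 1%N + r 2%N + r 3%N = 1 /\
  r 0%N *: a + r 1%N *: b + r 2%N *: c + r 3%N *: d = p.
Proof.
rewrite /bary => D0 /=; split.
  by rewrite -!mulrDl rvol_sum divff.
rewrite -[RHS](scalerK D0) -rvol_combination !scalerDr !scalerA.
by rewrite ![_^-1 * _]mulrC.
Qed.

Lemma bary_unique a b c d s t u v : rvol a b c d != 0 -> s + t + u + v = 1 ->
  bary a b c d (s *: a + t *: b + u *: c + v *: d) = [:: s; t; u; v].
Proof.
move=> D0 /(canRL (addrK _)) /(canRL (addrK _)) /(canRL (addrK _)) s1.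
rewrite /bary /= s1.
have E r r' : r = r' * rvol a b c d -> r / rvol a b c d = r' by move=> ->; rewrite mulfK.
by congr [:: _; _; _; _]; apply: E; rewrite /rvol /vol !mxE; ring.
Qed.

Lemma baryP a b c d p : rvol a b c d != 0 ->
  exists s t u v, [/\ s + t + u + v = 1, p = s *: a + t *: b + u *: c + v *: d
    & bary a b c d p = [:: s; t; u; v]].
Proof. by move=> /baryK-/(_ p)[s1 pE]; do 4!eexists; split; [exact: s1|exact/esym|]. Qed.

(** [o + k *: x] is the affine combination of [o] and [o + x] with weights [1 - k] and [k]. This
    yields the homogeneity of the gauge below. *)
Lemma bary_affine a b c d o x (k : R) i :
  let r p := nth 0 (bary a b c d p) i in
  r (o + k *: x) = (1 - k) * r o + k * r (o + x).
Proof.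
move=> r; rewrite {}/r /bary; case: i => [|[|[|[|i]]]] /=;
  last by rewrite nth_nil !mulr0 addr0.
all: by rewrite !mulrA -mulrDl; congr (_ / _); rewrite /rvol /vol !mxE; ring.
Qed.

Lemma bary_continuous a b c d i : continuous (fun p => nth 0 (bary a b c d p) i).
Proof.
have cst z : continuous (fun p : V3 => (z : V3)).
  exact: cst_continuous.
have id : continuous (fun p : V3 => (p : V3)) by move=> p; exact: cvg_id.
have quot (f : V3 -> R) : continuous f -> continuous (fun p => f p / rvol a b c d).
  by move=> fc p; exact: (continuousM (fc p) (@cst_continuous _ _ (rvol a b c d)^-1 p)).
rewrite /bary; case: i => [|[|[|[|i]]]] /=; last by rewrite nth_nil; exact: cst_continuous.
- exact: (quot _ (rvol_continuous id (cst b) (cst c) (cst d))).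
- exact: (quot _ (rvol_continuous (cst a) id (cst c) (cst d))).
- exact: (quot _ (rvol_continuous (cst a) (cst b) id (cst d))).
- exact: (quot _ (rvol_continuous (cst a) (cst b) (cst c) id)).
Qed.

(** Bounded, because the coordinates lie between 0 and 1; closed, as an intersection of four closed
    half-spaces. *)
Lemma tetrahedron_compact a b c d : rvol a b c d != 0 -> compact (tetrahedron a b c d).
Proof.
move=> D0; apply: bounded_closed_compact.
  exists (`|a| + `|b| + `|c| + `|d|); split; first by rewrite num_real.
  move=> M /ltW ltM p; change (all (>= 0) (bary a b c d p) -> `|p| <= M).
  have [s [t [u [v [s1 pE ->]]]]] := baryP p D0.
  move=> /= /and5P[s0 t0 u0 v0 _]; rewrite pE; apply: le_trans ltM.
  have le (k : R) x : 0 <= k <= 1 -> `|k *: x| <= `|x|.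
    by move=> /andP[k0 k1]; rewrite normrZ ger0_norm // ler_piMl.
  by do 3?[apply: (le_trans (ler_normD _ _)); apply: lerD]; apply: le; lra.
rewrite (_ : tetrahedron _ _ _ _ = \bigcap_(i in [set i | (i < 4)%N])
    (fun p => nth 0 (bary a b c d p) i) @^-1` [set r | 0 <= r]).
  apply: closed_bigI => i _; apply: closed_comp (@closed_ge _ 0) => p _.
  exact: bary_continuous.
apply/seteqP; split=> p /=.
  by move=> /= /and5P[? ? ? ? _] [|[|[|[|i]]]].
move=> p0; apply/and5P; split=> //.
- exact: (p0 0%N).
- exact: (p0 1%N).
- exact: (p0 2%N).
- exact: (p0 3%N).
Qed.

(** The gauge is the Minkowski functional centred at the centroid [o]: the maximum of four affine
    functions [e i], each equal to 0 at [o] and to 1 on the plane of one face. *)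
Lemma tetrahedron_gauge a b c d : rvol a b c d != 0 ->
  exists g : V3 -> R,
  [/\ continuous g,
      forall p, (g p <= 1) = all (>= 0) (bary a b c d p),
      forall p, (g p < 1) = all (> 0) (bary a b c d p)
    & tame_2sphere ((Some : V3 -> S3 R) @` [set p | g p = 1])].
Proof.
move=> D0.
pose e i p : R := 1 - 4 * nth 0 (bary a b c d p) i.
pose o := 4^-1 *: a + 4^-1 *: b + 4^-1 *: c + 4^-1 *: d.
have oE : bary a b c d o = nseq 4 4^-1 by apply: bary_unique => //; lra.
pose rho x := Num.max (Num.max (e 0%N (o + x)) (e 1%N (o + x)))
                      (Num.max (e 2%N (o + x)) (e 3%N (o + x))).
pose g p := rho (p - o).
have ec i : continuous (e i).
  move=> p; exact: (continuousB (@cst_continuous _ _ (1 : R) p)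
    (continuousM (@cst_continuous _ _ (4 : R) p) (@bary_continuous a b c d i p))).
have oc : continuous (fun x => o + x).
  by move=> x; exact: (continuousD (@cst_continuous _ _ o x) cvg_id).
have rc : continuous rho.
  move=> x; have eoc i : {for x, continuous (fun x => e i (o + x) : R^o)}.
    exact: (continuous_comp (oc x) (@ec i (o + x))).
  exact: (continuous_max (continuous_max (eoc _) (eoc _)) (continuous_max (eoc _) (eoc _))).
have gc : continuous g.
  move=> p.
  exact: (continuous_comp (continuousB cvg_id (@cst_continuous _ _ o p)) (rc _)).
have gle p : (g p <= 1) = all (>= 0) (bary a b c d p).
  rewrite /g /rho addrC subrK !ge_max /e /bary /= andbT -!andbA.
  have E (r : R) : (1 - 4 * r <= 1) = (0 <= r) by apply/idP/idP; lra.
  by rewrite !E.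
have glt p : (g p < 1) = all (> 0) (bary a b c d p).
  rewrite /g /rho addrC subrK !gt_max /e /bary /= andbT -!andbA.
  have E (r : R) : (1 - 4 * r < 1) = (0 < r) by apply/idP/idP; lra.
  by rewrite !E.
exists g; split => //.
have rh k x : 0 < k -> rho (k *: x) = k * rho x.
  move=> k0; have eh i : (i < 4)%N -> e i (o + k *: x) = k * e i (o + x).
    by move=> i4; rewrite /e bary_affine oE nth_nseq i4; field.
  by rewrite /rho !eh // !maxr_pMr ?ltW.
(* If no [e i] is positive, all four coordinates are at least 1/4; as they add up to 1, the point is
   the centroid. *)
have rp x : x != 0 -> 0 < rho x.
  move=> x0; rewrite ltNge !ge_max /e; apply: contra x0.
  have [s [t [u [v [s1 xE ->]]]]] := baryP (o + x) D0.
  move=> /= /andP[/andP[s0 t0] /andP[u0 v0]].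
  have [sE tE uE vE] : [/\ s = 4^-1, t = 4^-1, u = 4^-1 & v = 4^-1] by split; lra.
  by move: xE; rewrite sE tE uE vE -/o -[RHS]addr0 => /addrI /eqP.
have [f [fc fi fS]] := gauge_sphere o rc rh rp.
split; last by exists f.
(* The level set is already polyhedral, being the union of the four faces: there the coordinates are
   nonnegative and at least one vanishes. *)
exists id.
  by split; [move=> x; exact: cvg_id|exists id; split=> // x; exact: cvg_id].
rewrite image_id; exists [:: [:: b; c; d]; [:: a; c; d]; [:: a; b; d]; [:: a; b; c]].
congr (_ @` _); apply/seteqP; split=> p /=.
  move=> gp; have := glt p; rewrite gp ltxx; have := gle p; rewrite gp lexx.
  have [s [t [u [v [s1 pE ->]]]]] := baryP p D0.
  move=> /esym /= /and5P[s0 t0 u0 v0 _] /esym /negbT.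
  rewrite !lt_def s0 t0 u0 v0 !andbT !negb_and !negbK.
  case/or4P => /eqP z; move: s1; rewrite pE z ?add0r ?addr0 ?scale0r => s1.
  - exists [:: b; c; d] => /=; first by rewrite !inE eqxx.
    by rewrite add0r; apply/convex_hull3; exists t, u, v.
  - exists [:: a; c; d] => /=; first by rewrite !inE eqxx orbT.
    by rewrite addr0; apply/convex_hull3; exists s, u, v.
  - exists [:: a; b; d] => /=; first by rewrite !inE eqxx !orbT.
    by rewrite addr0; apply/convex_hull3; exists s, t, v.
  - exists [:: a; b; c] => /=; first by rewrite !inE eqxx !orbT.
    by rewrite addr0; apply/convex_hull3; exists s, t, u.
have face s t u v : p = s *: a + t *: b + u *: c + v *: d ->
    s + t + u + v = 1 -> all (>= 0) [:: s; t; u; v] -> ~~ all (> 0) [:: s; t; u; v] ->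
    g p = 1.
  move=> -> s1 s0 sp; apply/eqP; rewrite eq_le gle leNgt glt bary_unique // s0.
  by rewrite (negbTE sp).
move=> [h]; rewrite /= !inE => /or4P[] /eqP -> /convex_hull3[s [t [u]]] [s0 t0 u0 s1 pE].
- by apply: (face 0 s t u); rewrite /= ?scale0r ?add0r ?s0 ?t0 ?u0 ?lexx ?ltxx.
- by apply: (face s 0 t u); rewrite /= ?scale0r ?addr0 ?s0 ?t0 ?u0 ?lexx ?ltxx ?andbF.
- by apply: (face s t 0 u); rewrite /= ?scale0r ?addr0 ?s0 ?t0 ?u0 ?lexx ?ltxx ?andbF.
- by apply: (face s t u 0); rewrite /= ?scale0r ?addr0 ?s0 ?t0 ?u0 ?lexx ?ltxx ?andbF.
Qed.

(** The boundary of [abcd] is the splitting sphere, with a point of [L i] inside and a point of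
    [L j] outside. *)
Lemma tetrahedron_split n (L : 'I_n -> set (S3 R)) a b c d i j :
  rvol a b c d != 0 -> L i `<=` Some @` open_tetrahedron a b c d ->
  (forall k, k != i -> L k `<=` Some @` (~` tetrahedron a b c d)) ->
  L i !=set0 -> j != i -> L j !=set0 -> split_link L.
Proof.
move=> D0 Li Lo [x Lix] ji [y Ljy].
have [g [gc gle glt gS]] := tetrahedron_gauge D0.
have gT z : tetrahedron a b c d z = (g z <= 1) by rewrite gle.
have gO z : open_tetrahedron a b c d z = (g z < 1) by rewrite glt.
have [p gp px] := Li _ Lix; have [q gq qy] := Lo _ ji _ Ljy.
exists (Some @` [set p | g p = 1]); split => //.
  move=> k; apply/seteqP; split=> // z [Lkz [r /= gr rz]].
  have [ki|ki] := eqVneq k i.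
    by move: Lkz; rewrite ki -rz => /Li [r' + [rE]]; rewrite rE gO gr ltxx.
  by move: Lkz; rewrite -rz => /(Lo _ ki) [r' + [rE]]; rewrite rE /= gT gr lexx.
exists i, j, x, y; split => //; rewrite -px -qy.
apply: level_sphere_separates => //.
- rewrite (_ : mkset _ = tetrahedron a b c d); first exact: tetrahedron_compact.
  by apply/seteqP; split=> z; rewrite gT.
- by rewrite -gO.
- by rewrite ltNge; apply/negP; move: gq; rewrite /= gT.
Qed.

(** * Thin tetrahedra around a triangle *)

(** For [s = 0] this is the flat triangle [abc]; the vertex [d] fixes the transversal coordinate
    [w]. *)
Definition thickening a b c d (s : R) : set V3 := [set p | exists t u v w,
  [/\ bary a b c d p = [:: t; u; v; w], - s <= t, - s <= u, - s <= v & `|w| <= s]].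

Lemma thin_tetrahedron a b c d (s : R) : rvol a b c d != 0 -> 0 < s <= 1 ->
  exists a' b' c' d', [/\ rvol a' b' c' d' != 0,
    convex_hull [:: a; b; c] `<=` open_tetrahedron a' b' c' d'
    & tetrahedron a' b' c' d' `<=` thickening a b c d s].
Proof.
move=> D0 /andP[s0 s1].
have [n1 n2] : 1 + s != 0 /\ 1 + 2 * s != 0 by split; apply: lt0r_neq0; lra.
(* [g] is the centroid.  The depth [s ^+ 2] below the plane [abc] is small
   compared with the height [s] of the apex, so that the section by this plane
   still contains [abc] in its interior. *)
pose g := 3^-1 *: a + 3^-1 *: b + 3^-1 *: c.
(* Dilation about [g] by the factor [1 + 2 * s], followed by the shift to depth [s ^+ 2]. *)
pose push x := (1 + 2 * s) *: x - (2 * s) *: g - s ^+ 2 *: (d - g).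
pose top := g + s *: (d - g).
have D'0 : rvol (push a) (push b) (push c) top != 0.
  have -> : rvol (push a) (push b) (push c) top =
      (1 + 2 * s) ^+ 2 * s * (1 + s) * rvol a b c d.
    by rewrite /rvol /vol !mxE; field.
  by rewrite !mulf_neq0 ?expf_neq0 // gt_eqF.
exists (push a), (push b), (push c), top; split=> // [p|p].
  move=> /convex_hull3[t [u [v [t0 u0 v0 s1' ->]]]].
  (* The weight [s / (1 + s)] of [top] balances its height [s] against the depth [s ^+ 2] of the
     base. The centroid then contributes [- k] to each of the other coordinates, which the summand
     [k] makes up for. *)
  pose k := s / (3 * (1 + s)).
  have k0 : 0 < k by rewrite divr_gt0 // mulr_gt0 //; lra.
  have w0 : 0 < s / (1 + s) by rewrite divr_gt0 //; lra.
  have r0 (x : R) : 0 <= x -> 0 < (x + k) / (1 + 2 * s).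
    by move=> x0; rewrite divr_gt0 //; lra.
  have tE : t = 1 - u - v by lra.
  rewrite (_ : _ + _ + _ = ((t + k) / (1 + 2 * s)) *: push a +
     ((u + k) / (1 + 2 * s)) *: push b + ((v + k) / (1 + 2 * s)) *: push c +
     (s / (1 + s)) *: top).
    rewrite /open_tetrahedron /mkset bary_unique //= ?r0 ?w0 // /k tE.
    by field; rewrite n1 n2.
  by apply/rowP => i; rewrite /k tE !mxE; field; rewrite n1 n2.
rewrite /tetrahedron /mkset.
have [x [y [z [w [sE pE ->]]]]] := baryP p D'0.
move=> /= /and5P[x0 y0 z0 w0 _].
(* Expanding [push] and [top] in terms of [a], [b], [c], [d] and the centroid, [h] is a third of the
   coefficient of the centroid. *)
pose h := w * (1 - s) / 3 - (x + y + z) * (s * (2 - s) / 3).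
have xyz : x + y + z = 1 - w by lra.
have hs : - s <= h.
  have h1 : 0 <= w * (1 - s) by rewrite mulr_ge0 // subr_ge0.
  have h2 : (1 - w) * (s * (2 - s)) <= s * (2 - s).
    rewrite ler_piMl ?mulr_ge0 //; lra.
  have h3 : 0 <= s * s by rewrite mulr_ge0 // ltW.
  by rewrite /h xyz; lra.
have h4 (m : R) : 0 <= m -> - s <= (1 + 2 * s) * m + h.
  by move=> m0; have : 0 <= (1 + 2 * s) * m; [rewrite mulr_ge0 //; lra|lra].
exists ((1 + 2 * s) * x + h), ((1 + 2 * s) * y + h), ((1 + 2 * s) * z + h),
  (s * w - s ^+ 2 * (1 - w)).
split; rewrite ?h4 //.
  have zE : z = 1 - w - x - y by lra.
  rewrite -(bary_unique D0); last by rewrite /h zE; field.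
  by congr bary; apply/rowP => i; rewrite pE /h zE !mxE; field.
have w1 : w <= 1 by lra.
have : 0 <= s * w <= s by rewrite mulr_ge0 ?ler_piMr // ltW.
have : 0 <= s ^+ 2 * (1 - w) <= s * 1.
  rewrite mulr_ge0 ?sqr_ge0 ?subr_ge0 // expr2 -mulrA ler_pM2l //.
  by rewrite mulr_ile1 ?subr_ge0 //; lra.
by rewrite ler_norml => /andP[? ?] /andP[? ?]; lra.
Qed.

Lemma thickening_sub a b c d (s s' : R) : s <= s' ->
  thickening a b c d s `<=` thickening a b c d s'.
Proof.
move=> ss' p [t [u [v [w [E ? ? ? /le_trans-/(_ _ ss') ?]]]]].
by exists t, u, v, w; split=> //; lra.
Qed.

(** A continuous measure of the distance to the triangle has a positive minimum on the compact
    segment, but is small on a thin thickening. *)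
Lemma segment_gap a b c d p q : rvol a b c d != 0 ->
  convex_hull [:: a; b; c] `&` convex_hull [:: p; q] = set0 ->
  exists2 s : R, 0 < s <= 1 & convex_hull [:: p; q] `&` thickening a b c d s = set0.
Proof.
move=> D0 abcpq.
(* [m] is nonnegative and vanishes exactly on the triangle [abc]. *)
pose r i x := nth 0 (bary a b c d x) i.
pose m x : R := `|r 0%N x| - r 0%N x + (`|r 1%N x| - r 1%N x) + (`|r 2%N x| - r 2%N x)
            + `|r 3%N x|.
pose l (t : R) : V3 := (1 - t) *: p + t *: q.
pose F (t : R) : R := m (l t).
have Fc : continuous F.
  move=> t.
  have lc : continuous_at t l by exact: segment_continuous.
  have rc i : continuous_at t (fun t => r i (l t)).
    have ri : continuous (r i) by exact: bary_continuous.
    exact: (continuous_comp lc (ri (l t))).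
  have nc i : continuous_at t (fun t => `|r i (l t)|).
    exact: (continuous_comp (rc i) (@norm_continuous _ R^o _)).
  have bc i := continuousB (nc i) (rc i).
  exact: (continuousD (continuousD (continuousD (bc _) (bc _)) (bc _)) (nc _)).
have [t0 /[!in_itv]/= t01 Fmin] := EVT_min ler01 (continuous_subspaceT Fc).
have neg (z : R) : 0 <= `|z| - z by rewrite subr_ge0 ler_norm.
have F0 : 0 < F t0.
  have F_ge0 : 0 <= F t0.
    exact: (addr_ge0 (addr_ge0 (addr_ge0 (neg _) (neg _)) (neg _)) (normr_ge0 _)).
  rewrite lt_neqAle F_ge0 andbT; apply/eqP => /esym.
  rewrite /F; set x := l t0.
  have xpq : convex_hull [:: p; q] x by rewrite convex_hull2; exists t0; rewrite //= in_itv.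
  have [z0 [z1 [z2 [z3 [zs xE rE]]]]] := baryP x D0.
  rewrite /m /r rE /= => m0.
  have := (normr_ge0 z3, neg z0, neg z1, neg z2) => -[[[n3 n0] n1] n2].
  have z30 : z3 = 0 by apply/eqP; rewrite -normr_eq0 eq_le normr_ge0 andbT; lra.
  suff : (convex_hull [:: a; b; c] `&` convex_hull [:: p; q]) x by rewrite abcpq.
  have pos (z : R) : `|z| - z = 0 -> 0 <= z by have := normr_ge0 z; lra.
  split=> //; apply/convex_hull3; exists z0, z1, z2; split.
  - by apply: pos; lra.
  - by apply: pos; lra.
  - by apply: pos; lra.
  - by rewrite -zs z30 addr0.
  - by rewrite {1}xE z30 scale0r addr0.
(* On the thickening of width [s], [m] is at most [7 * s]: [2 * s] from each of three coordinates
   and [s] from the last. Hence the divisor 8. *)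
exists (Num.min (F t0 / 8) 1).
  by rewrite lt_min ltr01 ge_min lexx orbT andbT divr_gt0.
apply/seteqP; split=> // x [+ xT]; rewrite convex_hull2 => -[t t01' tx].
have := Fmin _ t01'; have -> : F t = m x by rewrite /F [l t]tx.
have /thickening_sub/(_ _ xT) : Num.min (F t0 / 8) 1 <= F t0 / 8 by rewrite ge_min lexx.
move=> [z0 [z1 [z2 [z3 [rE z0e z1e z2e z3e]]]]].
rewrite /m /r rE /=.
have neg' (z : R) : - (F t0 / 8) <= z -> `|z| - z <= 2 * (F t0 / 8).
  by move=> ze; have [] := ler0P z; lra.
have := (neg' _ z0e, neg' _ z1e, neg' _ z2e) => -[[? ?] ?].
lra.
Qed.

Lemma segments_gap a b c d (es : seq (V3 * V3)) : rvol a b c d != 0 ->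
  (forall e, e \in es ->
     convex_hull [:: a; b; c] `&` convex_hull [:: e.1; e.2] = set0) ->
  exists2 s : R, 0 < s <= 1 &
    forall e, e \in es -> convex_hull [:: e.1; e.2] `&` thickening a b c d s = set0.
Proof.
move=> D0; elim: es => [_|e es IH ese]; first by exists 1; rewrite ?ltr01 ?lexx.
have [|s /andP[s0 s1] sP] := IH; first by move=> f fes; apply: ese; rewrite inE fes orbT.
have [|s' /andP[s'0 s'1] s'P] := @segment_gap a b c d e.1 e.2 D0.
  by apply: ese; rewrite mem_head.
exists (Num.min s s'); first by rewrite lt_min s0 s'0 ge_min s1.
have st : Num.min s s' <= s by rewrite ge_min lexx.
have s't : Num.min s s' <= s' by rewrite ge_min lexx orbT.
move=> f; rewrite inE => /orP[/eqP ->|fes]; apply/seteqP; split=> // x [fx Tx].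
  by rewrite -s'P; split=> //; apply: thickening_sub Tx.
by rewrite -(sP _ fes); split=> //; apply: thickening_sub Tx.
Qed.

(** Some thickening of the triangle misses all the segments, and it contains a tetrahedron with the
    triangle in its interior. *)
Lemma triangle_split n (L : 'I_n -> set (S3 R)) a b c d (es : seq (V3 * V3)) i j :
  rvol a b c d != 0 ->
  (forall e, e \in es ->
     convex_hull [:: a; b; c] `&` convex_hull [:: e.1; e.2] = set0) ->
  L i `<=` Some @` convex_hull [:: a; b; c] ->
  (forall k, k != i ->
     L k `<=` Some @` \bigcup_(e in [set` es]) convex_hull [:: e.1; e.2]) ->
  L i !=set0 -> j != i -> L j !=set0 -> split_link L.
Proof.
move=> D0 ese Li Lk Li0 ji Lj0.
have [s s01 sP] := segments_gap D0 ese.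
have [a' [b' [c' [d' [D'0 abcT TT]]]]] := thin_tetrahedron D0 s01.
apply: (tetrahedron_split D'0 _ _ Li0 ji Lj0).
  by move=> x /Li [p /abcT pT <-]; exists p.
move=> k /Lk Lk' x /Lk' [p [e /= ees pe] <-]; exists p => // /TT pT.
by have : (convex_hull [:: e.1; e.2] `&` thickening a b c d s) p by []; rewrite sP.
Qed.

(** * Separating a triangle from a segment by a plane *)

Lemma rvol_affine3 a b c p q x (s t u : R) : s + t + u = 1 ->
  rvol a b c (s *: p + t *: q + u *: x) =
  s * rvol a b c p + t * rvol a b c q + u * rvol a b c x.
Proof. by move=> stu; rewrite (_ : s = 1 - t - u) ?/rvol ?/vol ?mxE; [ring|lra]. Qed.

Lemma rvol_eq3 a b c : [/\ rvol a b c a = 0, rvol a b c b = 0 & rvol a b c c = 0].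
Proof. by rewrite /rvol /vol; split; ring. Qed.

(** Multiplying the relation by [r] gives a vanishing sum of two nonnegative terms, whichever sign
    [r] and [r'] share. *)
Lemma same_sign_comb (r r' s t : R) : 0 < r * r' -> 0 <= s -> 0 <= t ->
  s * r + t * r' = 0 -> s = 0 /\ t = 0.
Proof.
move=> rr' s0 t0 st0.
have r2 : 0 < r ^+ 2.
  by rewrite exprn_even_gt0 //=; apply: contraTneq rr' => ->; rewrite mul0r ltxx.
have E : s * r ^+ 2 + t * (r * r') = 0.
  by rewrite -[RHS](mulr0 r) -st0; ring.
have := paddr_eq0 (mulr_ge0 s0 (ltW r2)) (mulr_ge0 t0 (ltW rr')).
rewrite E eqxx => /esym/andP[].
by rewrite mulf_eq0 (gt_eqF r2) orbF => /eqP ->; rewrite mulf_eq0 (gt_eqF rr') orbF => /eqP.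
Qed.

Lemma convex_hullC p q : convex_hull [:: q; p] = convex_hull [:: p; q].
Proof.
have sub p' q' : convex_hull [:: q'; p'] `<=` convex_hull [:: p'; q'].
  rewrite !convex_hull2 => x [t /=]; rewrite in_itv /= => t01 <-.
  by exists (1 - t); rewrite /= ?in_itv /= ?subKr 1?addrC //; lra.
by apply/seteqP; split.
Qed.

(** [rvol a b c] vanishes on the triangle and has a constant nonzero sign on the segment. *)
Lemma plane_separates a b c p q : 0 < rvol a b c p * rvol a b c q ->
  convex_hull [:: a; b; c] `&` convex_hull [:: p; q] = set0.
Proof.
move=> pq; apply/seteqP; split=> // x [/convex_hull3[s [t [u [s0 t0 u0 stu xE]]]]].
rewrite convex_hull2 => -[r /= + xE']; rewrite in_itv /= => /andP[r0 r1].
have := rvol_affine3 a b c a b c stu; have [-> -> ->] := rvol_eq3 a b c.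
rewrite -xE -xE' (rvol_affine _ _ _ _ _ (subrK _ _)) !mulr0 !addr0.
move=> /(same_sign_comb pq) [|//|r1' r0']; first by rewrite subr_ge0.
lra.
Qed.

(** With [b] and [c] strictly on one side of the plane [pqa], the triangle meets this plane in [a]
    only, and [a] is not on the line [pq]. *)
Lemma plane_through_edge_separates a b c p q : 0 < rvol p q a b * rvol p q a c ->
  convex_hull [:: a; b; c] `&` convex_hull [:: p; q] = set0.
Proof.
move=> bc; apply/seteqP; split=> // x [/convex_hull3[s [t [u [s0 t0 u0 stu xE]]]]].
rewrite convex_hull2 => -[r /= + xE']; rewrite in_itv /= => /andP[r0 r1].
have line y : rvol p q y x = 0.
  rewrite -xE' (rvol_affine _ _ _ _ _ (subrK _ _)).
  by have [-> -> _] := rvol_eq3 p q y; rewrite !mulr0 addr0.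
have := rvol_affine3 p q a a b c stu; have [_ _ ->] := rvol_eq3 p q a.
rewrite -xE line mulr0 add0r => /esym /(same_sign_comb bc t0 u0) [tz uz].
have xa : x = a.
  by rewrite xE -(addrK t s) -(addrK u (s + t)) stu tz uz !subr0 scale1r
    !scale0r !addr0.
move: bc; have := line b; rewrite xa rvol_swap34 => /eqP; rewrite oppr_eq0 => /eqP ->.
by rewrite mul0r ltxx.
Qed.

Lemma convex_hull3_rot a b c : convex_hull [:: b; c; a] = convex_hull [:: a; b; c].
Proof.
have sub a' b' c' : convex_hull [:: b'; c'; a'] `<=` convex_hull [:: a'; b'; c'].
  move=> x /convex_hull3[s [t [u [s0 t0 u0 stu ->]]]]; apply/convex_hull3.
  by exists u, s, t; split=> //; [lra|rewrite addrC addrA].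
by apply/seteqP; split=> // x /sub /sub.
Qed.

Lemma convex_hull3_segment a b c p q :
  convex_hull [:: a; b; c] p -> convex_hull [:: a; b; c] q ->
  convex_hull [:: p; q] `<=` convex_hull [:: a; b; c].
Proof.
move=> /convex_hull3[s [t [u [s0 t0 u0 stu ->]]]].
move=> /convex_hull3[s' [t' [u' [s0' t0' u0' stu' ->]]]].
rewrite convex_hull2 => x [r /=]; rewrite in_itv /= => /andP[r0 r1] <-.
apply/convex_hull3; exists ((1 - r) * s + r * s'), ((1 - r) * t + r * t'),
  ((1 - r) * u + r * u').
split; rewrite ?addr_ge0 ?mulr_ge0 ?subr_ge0 //.
  have [-> ->] : s = 1 - t - u /\ s' = 1 - t' - u' by split; lra.
  by ring.
by apply/rowP => i; rewrite !mxE; ring.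
Qed.

End Geometry.

(** * The nine points *)

(** Found by simulated annealing over integer points. *)
Definition points : seq (seq nat) :=
  [:: [:: 2; 2; 2]; [:: 1; 5; 1]; [:: 4; 4; 2]; [:: 5; 4; 5]; [:: 0; 5; 2];
      [:: 2; 0; 1]; [:: 1; 3; 5]; [:: 2; 1; 0]; [:: 3; 4; 0]]%N.

Definition pt (K : comNzRingType) (i : nat) : 'I_3 -> K :=
  fun j => (nth 0%N (nth [::] points i) j)%:R.

Definition ivol i j k l : int := vol (@pt int i) (@pt int j) (@pt int k) (@pt int l).

(** In the following tests [if] replaces the boolean connectives, whose two
    arguments [vm_compute] always evaluates. *)
Definition general_position := all (fun i => all (fun j => all (fun k => all (fun l =>
  if uniq [:: i; j; k; l] then ivol i j k l != 0 else true)
  (iota 0 9)) (iota 0 9)) (iota 0 9)) (iota 0 9).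

(** The triangle [abc] and the segment [pq] are separated by a plane through
    three of the five points: [abc], or [pq] and a vertex of [abc]. *)
Definition unpierced (a b c p q : nat) :=
  if 0 < ivol a b c p * ivol a b c q then true else
  if 0 < ivol p q a b * ivol p q a c then true else
  if 0 < ivol p q b a * ivol p q b c then true else
  0 < ivol p q c a * ivol p q c b.

(** Not symmetric: the flat triangle of [t] is tested against the three sides of [u]. *)
Definition clear (t u : seq nat) :=
  if (t, u) is ([:: a; b; c], [:: x; y; z]) then
    if unpierced a b c x y then
      if unpierced a b c y z then unpierced a b c x z else false
    else false
  else false.

(** On triples, the shape that the choice of labels keeps from being a directed cycle. *)
Definition star (t : seq nat) :=
  (0%N \in t) && (count (fun i => 1 <= i <= 4)%N t == 2%N).

Definition splittable t u v :=
  if [|| star t, star u | star v] then true else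
  if (if clear t u then clear t v else false) then true else
  if (if clear u t then clear u v else false) then true else
  if clear v t then clear v u else false.

(** Increasing triples represent each three-element set of labels once. *)
Definition all_triples (P : seq nat -> bool) :=
  all (fun i => all (fun j => all (fun k =>
    if sorted ltn [:: i; j; k] then P [:: i; j; k] else true)
  (iota 0 9)) (iota 0 9)) (iota 0 9).

Definition disj (s t : seq nat) := ~~ has [in s] t.

(** Each partition is met in all six orders of its parts, so the result applies to the components of
    a link as they are numbered. *)
Definition splittable_partitions :=
  all_triples (fun t => all_triples (fun u =>
    if disj t u then
      all_triples (fun v =>
        if disj t v && disj u v then splittable t u v else true)
    else true)).

Lemma general_positionE : general_position.
Proof. by vm_compute. Qed.

Lemma splittable_partitionsE : splittable_partitions.
Proof. by vm_compute. Qed.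

Section Configuration.
Variable R : realType.
Notation V3 := 'rV[R]_3.

Definition point (i : nat) : V3 := \row_j pt R i j.

Lemma rvol_point i j k l :
  rvol (point i) (point j) (point k) (point l) = (ivol i j k l)%:~R.
Proof.
have pE m n : point m ord0 n = (pt int m n)%:~R by rewrite mxE /pt rmorph_nat.
by rewrite /ivol /rvol /vol !pE !(rmorphB, rmorphD, rmorphM).
Qed.

Lemma unpiercedP i j k l m : unpierced i j k l m ->
  convex_hull [:: point i; point j; point k] `&` convex_hull [:: point l; point m] = set0.
Proof.
rewrite /unpierced -!(ltr0z R) !rmorphM /= -!rvol_point.
case: ifP => [+ _|_]; first exact: plane_separates.
case: ifP => [+ _|_]; first exact: plane_through_edge_separates.
case: ifP => [+ _|_].
  by rewrite mulrC -convex_hull3_rot; exact: plane_through_edge_separates.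
by rewrite -convex_hull3_rot -convex_hull3_rot; exact: plane_through_edge_separates.
Qed.

Definition triangle (t : seq nat) : set V3 := convex_hull [seq point i | i <- t].

Lemma clearP t u i j : clear t u -> i \in u -> j \in u -> i != j ->
  triangle t `&` convex_hull [:: point i; point j] = set0.
Proof.
rewrite /triangle /clear; case: t => [|a [|b [|c [|]]]] //.
case: u => [|x [|y [|z [|]]]] //=.
case: ifP => // /unpiercedP xy; case: ifP => // /unpiercedP yz /unpiercedP xz.
rewrite !inE => /or3P[] /eqP -> /or3P[] /eqP ->; rewrite ?eqxx // => _ //;
  by rewrite convex_hullC.
Qed.

Lemma rvol_point_neq0 i j k l : uniq [:: i; j; k; l] -> all (gtn 9) [:: i; j; k; l] ->
  rvol (point i) (point j) (point k) (point l) != 0.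
Proof.
move=> ijkl /= /and5P[i9 j9 k9 l9 _].
have /allP/(_ i)/[!mem_iota]/(_ i9)/allP/(_ j) := general_positionE.
move=> /[!mem_iota]/(_ j9)/allP/(_ k)/[!mem_iota]/(_ k9)/allP/(_ l)/[!mem_iota]/(_ l9).
by rewrite ijkl rvol_point intr_eq0.
Qed.

(** Padded with zero weights to four labels, the relation holds among the vertices of a
    nondegenerate tetrahedron, where barycentric coordinates are unique. *)
Lemma point_independent (s : seq nat) (w : nat -> R) :
  uniq s -> (size s <= 4)%N -> all (gtn 9) s ->
  \sum_(i <- s) w i = 0 -> \sum_(i <- s) w i *: point i = 0 ->
  forall i, i \in s -> w i = 0.
Proof.
move=> us s4 s9 w0 wp0.
(* [s ++ r] extends [s] to four distinct labels. *)
pose r := take (4 - size s) [seq i <- iota 0 9 | i \notin s].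
have rs i : i \in r -> i \notin s by move=> /mem_take; rewrite mem_filter => /andP[].
have r9 i : i \in r -> (i < 9)%N.
  by move=> /mem_take; rewrite mem_filter mem_iota => /andP[_].
have ur : uniq (s ++ r).
  rewrite cat_uniq us take_uniq ?filter_uniq ?iota_uniq // andbT.
  by apply/hasPn => i /rs.
have sr : size (s ++ r) = 4%N.
  rewrite size_cat size_takel ?subnKC // leq_subLR (leq_trans (isT : 4 <= 9)%N) //.
  rewrite -size_cat -(size_iota 0 9) uniq_leq_size ?iota_uniq // => i i9.
  by rewrite mem_cat mem_filter i9 andbT orbN.
pose v i := if i \in s then w i else 0.
have vE (V : zmodType) (f : R -> nat -> V) : (forall i, f 0 i = 0) ->
    \sum_(i <- s ++ r) f (v i) i = \sum_(i <- s) f (w i) i.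
  move=> f0; rewrite big_cat /=.
  have -> : \sum_(i <- r) f (v i) i = 0.
    by rewrite big_seq big1 // => i /rs /negbTE si; rewrite /v si.
  by rewrite addr0; apply: eq_big_seq => i si; rewrite /v si.
have v0 := vE R (fun z _ => z) (fun=> erefl).
have vp0 := vE V3 (fun z i => z *: point i) (fun i => scale0r (point i)).
rewrite w0 in v0; rewrite wp0 in vp0.
suff vz i : i \in s ++ r -> v i = 0.
  by move=> i si; rewrite -(vz i) ?mem_cat ?si // /v si.
have sr9 : all (gtn 9) (s ++ r) by rewrite all_cat s9; apply/allP => j /r9.
move: {vE w0 wp0 rs r9} (s ++ r) ur sr sr9 v0 vp0 => [|j [|k [|l [|m [|]]]]] // ujklm _ j9.
have D0 := rvol_point_neq0 ujklm j9.
rewrite !big_cons !big_nil !addr0 => v0 vp0.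
(* Adding the relation to the coordinates [1, 0, 0, 0] of the first vertex gives coordinates of the
   same point. *)
have := @bary_unique _ _ _ _ _ (1 + v j) (v k) (v l) (v m) D0.
have := @bary_unique _ _ _ _ _ 1 0 0 0 D0; rewrite !addr0 => /(_ erefl).
rewrite !scale0r !addr0 scale1r => E.
rewrite scalerDl scale1r -!addrA vp0 v0 !addr0 E => /(_ erefl) [].
rewrite -[X in X = _]addr0 => /addrI vj vk vl vm.
by rewrite !inE => /or4P[] /eqP ->.
Qed.

End Configuration.

(** * The straight-line embedding *)

Section Embedding.
Variables (R : realType) (V : finType) (e : rel V) (lab : V -> nat).
Hypotheses (lab_inj : injective lab) (lab9 : forall x, (lab x < 9)%N).
Hypothesis eT : tournament e.
Local Notation place x := (point R (lab x)).

Lemma sum_delta (W : lmodType R) (s : seq nat) (F : nat -> W) i : uniq s -> i \in s ->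
  \sum_(j <- s) (j == i)%:R *: F j = F i.
Proof.
move=> us si; rewrite (bigD1_seq i) //= eqxx scale1r big1 ?addr0 // => j /negbTE ->.
by rewrite scale0r.
Qed.

(** The difference of the two sides is an affine relation among at most four points. Weights are
    collected by label, as the endpoints may coincide. *)
Lemma segment_combination x y x' y' (r s r' s' : R) : r + s = r' + s' ->
  r *: place x + s *: place y = r' *: place x' + s' *: place y' ->
  forall z, z \in [:: x; y; x'; y'] ->
  r * (z == x)%:R + s * (z == y)%:R = r' * (z == x')%:R + s' * (z == y')%:R.
Proof.
move=> rs E z zs; apply/eqP; rewrite -subr_eq0; apply/eqP.
pose w i : R := r * (i == lab x)%:R + s * (i == lab y)%:R
  - (r' * (i == lab x')%:R + s' * (i == lab y')%:R).
pose l := undup [seq lab z | z <- [:: x; y; x'; y']].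
have ml t : t \in [:: x; y; x'; y'] -> lab t \in l by move=> tl; rewrite mem_undup map_f.
(* Used twice: with [F] constant for the sum of the weights, and with the points themselves. *)
have lin (W : lmodType R) (F : nat -> W) : \sum_(i <- l) w i *: F i =
    r *: F (lab x) + s *: F (lab y) - (r' *: F (lab x') + s' *: F (lab y')).
  have sd t k : t \in [:: x; y; x'; y'] ->
      \sum_(i <- l) (k * (i == lab t)%:R) *: F i = k *: F (lab t).
    move=> tl; rewrite -(sum_delta F (undup_uniq _) (ml _ tl)) scaler_sumr.
    by apply: eq_bigr => i _; rewrite scalerA.
  rewrite -!sd ?inE ?eqxx ?orbT // -!big_split -sumrB; apply: eq_bigr => i _.
  by rewrite /w scalerBl !scalerDl.
have l9 : all (gtn 9) l by apply/allP => i; rewrite mem_undup => /mapP[t _ ->] /=.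
have w0 : \sum_(i <- l) w i = 0.
  have := lin R^o (fun=> 1); rewrite !/(_ *: _) /= !mulr1 -rs subrr => w0.
  by apply: etrans w0; apply: eq_bigr => i _; exact: (esym (mulr1 _)).
have l4 : (size l <= 4)%N by exact: size_undup.
have := point_independent (undup_uniq _) l4 l9 w0.
rewrite lin E subrr => /(_ erefl _ (ml z zs)) <-.
by rewrite /w !(inj_eq lab_inj).
Qed.

Definition straight_arc x y (t : R) : S3 R := Some ((1 - t) *: place x + t *: place y).

Lemma straight_embedding : exists f : embedding R e, Defs.arc f = straight_arc.
Proof.
have [eirr exor] := eT.
have neq x y : e x y -> x != y by apply: contraTneq => ->; rewrite eirr.
(* Vertices are treated as degenerate segments with weights 1 and 0. *)
have p_inj : injective (fun x => Some (place x) : S3 R).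
  move=> x y [xy]; apply/eqP; have := @segment_combination x x y y 1 0 1 0 erefl.
  rewrite xy => /(_ erefl x (mem_head _ _)).
  rewrite eqxx !mul0r !addr0 !mul1r.
  by case: (x == y) => //= /eqP; rewrite oner_eq0.
have a_cont x y : e x y -> {within `[0, 1], continuous (straight_arc x y)}.
  move=> _; apply: continuous_subspaceT => t.
  pose l (t : R) : 'rV[R]_3 := (1 - t) *: place x + t *: place y.
  have lc : continuous_at t l by exact: segment_continuous.
  have sc : continuous (Some : 'rV[R]_3 -> S3 R).
    exact: one_point_compactification_some_continuous.
  exact: (continuous_comp lc (sc _)).
have a_src x y : e x y -> straight_arc x y 0 = Some (place x).
  by move=> _; rewrite /straight_arc subr0 scale1r scale0r addr0.
have a_tgt x y : e x y -> straight_arc x y 1 = Some (place y).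
  by move=> _; rewrite /straight_arc subrr scale1r scale0r add0r.
have a_avoid x y z t : e x y -> t \in `]0, 1[ -> straight_arc x y t <> Some (place z).
  move=> /neq xy; rewrite in_itv /= => /andP[t0 t1] [E].
  have := @segment_combination x y z z (1 - t) t 1 0.
  rewrite subrK addr0 scale1r scale0r addr0 => /(_ erefl E x (mem_head _ _)).
  rewrite eqxx (negbTE xy) mulr0 mulr1 mul0r !addr0 mul1r.
  by case: (x == z) {E} => /=; lra.
have a_inj x y x' y' t t' : e x y -> e x' y' ->
    t \in `]0, 1[ -> t' \in `]0, 1[ -> straight_arc x y t = straight_arc x' y' t' ->
    [/\ x = x', y = y' & t = t'].
  move=> exy exy'; rewrite !in_itv /= => /andP[t0 t1] /andP[t0' t1'] [E].
  have := @segment_combination x y x' y' (1 - t) t (1 - t') t'.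
  rewrite !subrK => /(_ erefl E) {E} C.
  have xy := neq _ _ exy; have hx := C x (mem_head _ _).
  have /C hy : y \in [:: x; y; x'; y'] by rewrite !inE eqxx orbT.
  move: hx hy; rewrite !eqxx [y == x]eq_sym (negbTE xy) !mulr0 !mulr1 add0r addr0 => hx hy.
  have [xx'|xx'] := eqVneq x x'.
    have yx' : (y == x') = false by rewrite -xx' eq_sym (negbTE xy).
    have yy' : y = y'.
      apply/eqP; apply: contraT => /negbTE yy'.
      by move: hy; rewrite yx' yy' !mulr0 addr0 => tz; rewrite tz ltxx in t0.
    by split => //; rewrite hy yx' yy' eqxx mulr0 mulr1 add0r.
  (* In the remaining case the two edges would be antiparallel, which a tournament excludes. *)
  have xy' : x = y'.
    apply/eqP; apply: contraT => /negbTE xy'.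
    move: hx; rewrite (negbTE xx') xy' !mulr0 addr0 => /eqP.
    by rewrite subr_eq0 => /eqP tz; rewrite -tz ltxx in t1.
  have yx' : y = x'.
    apply/eqP; apply: contraT => /negbTE yx'.
    move: hy; rewrite yx' -xy' eq_sym (negbTE xy) !mulr0 addr0 => tz.
    by rewrite tz ltxx in t0.
  by have := exor _ _ xy; rewrite exy yx' xy' exy'.
(* The drawing is itself a finite union of points and segments, so the identity is a suitable
   homeomorphism. *)
have tm : tame (range (fun x => Some (place x) : S3 R) `|`
    \bigcup_(p in [set p : V * V | e p.1 p.2]) (straight_arc p.1 p.2 @` `[0, 1])).
  exists id.
    by split; [move=> x; exact: cvg_id|exists id; split=> // x; exact: cvg_id].
  rewrite image_id; exists ([seq [:: place x] | x <- enum V] ++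
    [seq [:: place p.1; place p.2] | p <- enum {: V * V} & e p.1 p.2]).
  apply/seteqP; split=> x.
    case=> [[y _ <-]|[[y z] /= eyz [t t01 <-]]].
      exists (place y) => //; exists [:: place y]; last by rewrite convex_hull1.
      by rewrite /= mem_cat map_f ?mem_enum.
    exists ((1 - t) *: place y + t *: place z) => //; exists [:: place y; place z].
      rewrite /= mem_cat; apply/orP; right; apply/mapP; exists (y, z) => //.
      by rewrite mem_filter /= eyz mem_enum.
    by rewrite convex_hull2; exists t.
  case=> p [h /= + hp] <-; rewrite mem_cat => /orP[] /mapP[y].
    by move=> _ hE; move: hp; rewrite hE convex_hull1 => ->; left; exists y.
  rewrite mem_filter => /andP[ey _] hE; move: hp; rewrite hE convex_hull2.
  by move=> [t t01 <-]; right; exists y => //; exists t.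
by exists (Embedding p_inj a_cont a_src a_tgt a_avoid a_inj tm).
Qed.

End Embedding.

(** * Labellings, triples and directed cycles *)

(** The label is the position in a list of all vertices that begins with [x0] and four elements of
    [A]. *)
Lemma labelling (V : finType) (x0 : V) (A : {set V}) :
  #|V| = 9%N -> x0 \notin A -> (4 <= #|A|)%N ->
  exists lab : V -> nat, [/\ injective lab, forall x, (lab x < 9)%N, lab x0 = 0%N
    & forall x, (1 <= lab x <= 4)%N -> x \in A].
Proof.
move=> V9 x0A A4; pose l := take 4 (enum A).
have lA x : x \in l -> x \in A by move=> /mem_take; rewrite mem_enum.
have sl : size l = 4%N by rewrite size_takel // -cardE.
pose s := (x0 :: l) ++ [seq x <- enum V | x \notin x0 :: l].
have sV x : x \in s by rewrite /s mem_cat mem_filter mem_enum andbT orbN.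
have us : uniq s.
  rewrite /s cat_uniq filter_uniq ?enum_uniq // andbT cons_uniq.
  rewrite take_uniq ?enum_uniq // andbT.
  apply/andP; split; first by apply: contra x0A => /lA.
  by apply/hasPn => x; rewrite mem_filter => /andP[].
exists (index^~ s); split.
- by move=> x y xy; rewrite -(nth_index x0 (sV x)) xy nth_index.
- move=> x; rewrite -V9 cardT; apply: (@leq_trans (size s)); first by rewrite index_mem.
  by apply: uniq_leq_size => // y; rewrite mem_enum.
- by rewrite /s /= eqxx.
- move=> x /andP[x1 x4]; apply: lA.
  have := sV x; rewrite /s mem_cat inE -orbA => /or3P[/eqP xx0||xr].
  + by move: x1; rewrite xx0 /s /= eqxx.
  + by [].
  + move: x4; rewrite /s index_cat ifN; last by move: xr; rewrite mem_filter => /andP[].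
    by rewrite /= sl.
Qed.

Lemma all_triplesP (P : pred (seq nat)) (s : seq nat) : all_triples P ->
  sorted ltn s -> size s = 3%N -> all (gtn 9) s -> P s.
Proof.
case: s => [|i [|j [|k [|]]]] // + s3 _ /= /and4P[i9 j9 k9 _].
move=> /allP/(_ i)/[!mem_iota]/(_ i9)/allP/(_ j)/[!mem_iota]/(_ j9).
by move=> /allP/(_ k)/[!mem_iota]/(_ k9); rewrite s3.
Qed.

Lemma directed_cycle_size (V : finType) (e : rel V) (c : seq V) :
  tournament e -> directed_cycle e c -> (3 <= size c)%N.
Proof.
move=> [eirr exor]; case: c => [|x [|y [|z c]]] // /and3P[_ /=].
  by rewrite eirr.
rewrite inE andbT => /exor; case: (e x y); case: (e y x) => //.
Qed.

Lemma triangle_segment (R : realType) (t : seq nat) i j :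
  size t = 3%N -> i \in t -> j \in t ->
  convex_hull [:: point R i; point R j] `<=` @triangle R t.
Proof.
rewrite /triangle; case: t => [|a [|b [|c [|? ?]]]] // _ it jt.
have vertex k : k \in [:: a; b; c] ->
    convex_hull [:: point R a; point R b; point R c] (point R k).
  rewrite !inE => /or3P[] /eqP ->; apply/convex_hull3.
  - exists 1, 0, 0; rewrite scale1r !scale0r !(addr0, add0r).
    by rewrite lexx ler01.
  - exists 0, 1, 0; rewrite scale1r !scale0r !(addr0, add0r).
    by rewrite lexx ler01.
  - exists 0, 0, 1; rewrite scale1r !scale0r !(addr0, add0r).
    by rewrite lexx ler01.
exact: convex_hull3_segment (vertex _ it) (vertex _ jt).
Qed.

(** * Splitting the cycles of a labelled tournament *)

Section LabelledTournament.
Variables (R : realType) (V : finType) (e : rel V) (lab : V -> nat).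
Hypotheses (lab_inj : injective lab) (lab9 : forall x, (lab x < 9)%N).
Hypothesis eT : tournament e.

(** Filtering [iota] yields the increasing order in which [all_triples] enumerates; the cyclic order
    is forgotten. *)
Definition labels (c : seq V) := [seq i <- iota 0 9 | i \in map lab c].

Lemma mem_labels c i : (i \in labels c) = (i \in map lab c).
Proof.
rewrite mem_filter andb_idr // => /mapP[x _ ->].
by rewrite mem_iota lab9.
Qed.

Lemma labels_sorted c : sorted ltn (labels c).
Proof. by apply: sorted_filter; [exact: ltn_trans|exact: iota_ltn_sorted]. Qed.

Lemma labels_lt9 c : all (gtn 9) (labels c).
Proof. by apply/allP => i; rewrite mem_labels => /mapP[x _ ->]; exact: lab9. Qed.

Lemma labels_perm c : uniq c -> perm_eq (labels c) (map lab c).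
Proof.
move=> uc; apply: uniq_perm; last exact: mem_labels.
  by rewrite filter_uniq ?iota_uniq.
by rewrite map_inj_uniq.
Qed.

Lemma labels_disj c c' : (forall x, x \in c -> x \notin c') -> disj (labels c) (labels c').
Proof.
move=> cc'; apply/hasPn => i; rewrite !mem_labels => /mapP[x xc' ->].
by rewrite mem_map //; apply: contraTN xc' => /cc'.
Qed.

(** The predecessor and the successor of [x0] on the cycle would both have labels in 1..4, but the
    edges between [x0] and such vertices all leave [x0] or all enter it. *)
Lemma star_not_directed c x0 : lab x0 = 0%N ->
  (forall x, (1 <= lab x <= 4)%N -> e x0 x) \/ (forall x, (1 <= lab x <= 4)%N -> e x x0) ->
  directed_cycle e c -> size c = 3%N -> ~~ star (labels c).
Proof.
have [eirr exor] := eT; move=> lx0 dom /and3P[_ uc ec] sc.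
apply/negP => /andP[x0c /eqP]; rewrite (permP (labels_perm uc)) count_map => c2.
move: x0c; rewrite mem_labels -lx0 mem_map // => x0c.
(* Two of the three labels lie in 1..4 and that of [x0] does not; a second exception would be one
   too many. *)
have near y : y \in c -> y != x0 -> (1 <= lab y <= 4)%N.
  move=> yc yx0; apply: contraT => ny.
  have := count_predC (preim lab (fun i => 1 <= i <= 4)%N) c; rewrite c2 sc => -[c1].
  suff : (2 <= count (predC (preim lab (fun i => 1 <= i <= 4)%N)) c)%N.
    by move: c1; rewrite add0n => ->.
  rewrite -size_filter; apply: (@uniq_leq_size _ [:: x0; y]).
    by rewrite /= inE eq_sym yx0.
  by move=> z; rewrite !inE => /orP[] /eqP ->; rewrite mem_filter /= ?lx0 ?x0c // ny yc.
have en := next_cycle ec x0c; have ep := prev_cycle ec x0c.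
have nx0 : next c x0 != x0 by apply: contraTneq en => ->; rewrite eirr.
have px0 : prev c x0 != x0 by apply: contraTneq ep => ->; rewrite eirr.
case: dom => dom.
  have := dom _ (near _ _ px0); rewrite mem_prev x0c => /(_ isT) ep'.
  by have := exor _ _ px0; rewrite ep ep'.
have := dom _ (near _ _ nx0); rewrite mem_next x0c => /(_ isT) en'.
by have := exor _ _ nx0; rewrite en en'.
Qed.

Variable f : embedding R e.
Hypothesis fE : Defs.arc f = @straight_arc R V lab.

Lemma cycle_imageP c z : directed_cycle e c -> cycle_image f c z ->
  exists x y, [/\ x \in c, y \in c, x != y &
    (Some @` convex_hull [:: point R (lab x); point R (lab y)]) z].
Proof.
move=> /and3P[_ uc ec] [x /= xc [t t01 <-]]; exists x, (next c x); split=> //.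
- by rewrite mem_next.
- by apply: contraTneq (next_cycle ec xc) => <-; rewrite (proj1 eT).
- exists ((1 - t) *: point R (lab x) + t *: point R (lab (next c x))).
    by rewrite convex_hull2; exists t.
  by rewrite fE.
Qed.

(** By general position, a vertex of another cycle serves as the fourth point off the plane of the
    triangle. *)
Lemma clear_split n (c : 'I_n -> seq V) i j :
  (forall k, directed_cycle e (c k)) -> (forall k, size (c k) = 3%N) -> j != i ->
  (forall k x, k != i -> x \in c i -> x \notin c k) ->
  (forall k, k != i -> clear (labels (c i)) (labels (c k))) ->
  split_link (fun k => cycle_image f (c k)).
Proof.
move=> dc sc ji cd cl.
have nonempty k : exists2 x, x \in c k & cycle_image f (c k) !=set0.
  have := sc k; case ck: (c k) => [//|x s] _; exists x; first exact: mem_head.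
  exists (Defs.arc f x (next (x :: s) x) 0); exists x; first exact: mem_head.
  by exists 0; rewrite //= in_itv /= lexx ler01.
have uc k : uniq (c k) by have /and3P[] := dc k.
have sl k : size (labels (c k)) = 3%N.
  by rewrite (perm_size (labels_perm (uc k))) size_map.
have [y yj yne] := nonempty j; have [x xi xne] := nonempty i.
have := sl i; case ti: (labels (c i)) => [|a' [|b' [|c' [|]]]] // _.
have D0 : rvol (point R a') (point R b') (point R c') (point R (lab y)) != 0.
  apply: rvol_point_neq0.
    rewrite -[[:: _; _; _; _]]/(rcons [:: a'; b'; c'] (lab y)) -ti rcons_uniq mem_labels.
    rewrite filter_uniq ?iota_uniq // andbT mem_map //.
    by apply: contraTN yj => /(cd _ _ ji).
  rewrite -[[:: _; _; _; _]]/(rcons [:: a'; b'; c'] (lab y)) -ti all_rcons labels_lt9 andbT.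
  exact: lab9.
(* The sides of all the other triangles, each in both directions. *)
pose es := [seq (point R u.1, point R u.2) | u <- flatten
  [seq [seq (u, v) | u <- labels (c k), v <- labels (c k)] | k <- enum 'I_n & k != i] &
  u.1 != u.2].
apply: (@triangle_split R n _ _ _ _ _ es i j D0 _ _ _ xne ji yne).
- move=> w /mapP[[u v]]; rewrite mem_filter /= => /andP[uv] /flattenP[s /mapP[k]].
  rewrite mem_filter => /andP[ki _] -> /allpairsP[[u' v'] /= [uk vk [uE vE]]] ->.
  rewrite uE vE in uv *.
  have := clearP R (cl _ ki) uk vk uv.
  by rewrite ti.
- move=> z /(cycle_imageP (dc i)) [u [v [ui vi _ [p puv <-]]]]; exists p => //.
  rewrite -[convex_hull _]/(@triangle R [:: a'; b'; c']) -ti.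
  by apply: triangle_segment puv; rewrite ?mem_labels ?map_f.
- move=> k ki z /(cycle_imageP (dc k)) [u [v [uk vk uv [p puv <-]]]]; exists p => //.
  exists (point R (lab u), point R (lab v)) => //=.
  apply/mapP; exists (lab u, lab v) => //.
  rewrite mem_filter /= (inj_eq lab_inj) uv; apply/flattenP.
  exists [seq (u, v) | u <- labels (c k), v <- labels (c k)].
    by apply/mapP; exists k; rewrite // mem_filter ki mem_enum.
  by apply/allpairsP; exists (lab u, lab v); split; rewrite //= mem_labels map_f.
Qed.

Lemma splittable_split (c : 'I_3 -> seq V) x0 : #|V| = 9%N -> lab x0 = 0%N ->
  (forall x, (1 <= lab x <= 4)%N -> e x0 x) \/ (forall x, (1 <= lab x <= 4)%N -> e x x0) ->
  (forall k, directed_cycle e (c k)) ->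
  (forall i j x, i != j -> x \in c i -> x \notin c j) ->
  split_link (fun k => cycle_image f (c k)).
Proof.
move=> V9 lx0 dom dc cd.
pose i0 : 'I_3 := ord0; pose i1 : 'I_3 := 1; pose i2 : 'I_3 := 2%:R.
have cases (k : 'I_3) : [\/ k = i0, k = i1 | k = i2].
  by case: k => -[|[|[|//]]] ?; [apply: Or31|apply: Or32|apply: Or33]; apply: val_inj.
have uc k : uniq (c k) by have /and3P[] := dc k.
have s3 k : (3 <= size (c k))%N by exact: directed_cycle_size eT (dc k).
(* With at least three vertices on each cycle, this bound leaves exactly three for each. *)
have s9 : (size (c i0) + size (c i1) + size (c i2) <= 9)%N.
  rewrite -V9 cardT -!size_cat; apply: uniq_leq_size; last by move=> x; rewrite mem_enum.
  rewrite !cat_uniq !uc andbT /= andbT; apply/andP; split; apply/hasPn => x xc.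
    exact: cd xc.
  by rewrite mem_cat negb_or !(cd _ _ _ _ xc).
have sc k : size (c k) = 3%N.
  by move: (s3 i0) (s3 i1) (s3 i2) s9; case: (cases k) => ->; lia.
have ld i j : i != j -> disj (labels (c i)) (labels (c j)).
  by move=> ij; apply: labels_disj => x; apply: cd.
have nstar k := star_not_directed lx0 dom (dc k) (sc k).
have sl k : size (labels (c k)) = 3%N.
  by rewrite (perm_size (labels_perm (uc k))) size_map.
have H P k : all_triples P -> P (labels (c k)).
  by move=> /all_triplesP; apply; [exact: labels_sorted|exact: sl|exact: labels_lt9].
have := H _ i0 splittable_partitionsE; cbv beta => /(H _ i1); cbv beta.
rewrite ld // => /(H _ i2); cbv beta; rewrite !ld //.
rewrite /splittable !(negbTE (nstar _)).
have cs i j : j != i -> (forall k, k != i -> clear (labels (c i)) (labels (c k))) ->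
    split_link (fun k => cycle_image f (c k)).
  by move=> ji cl; apply: (clear_split dc sc ji _ cl) => k x ki; apply: cd; rewrite eq_sym.
case: ifP => [|_].
  case: ifP => // c01 c02 _; apply: (cs i0 i1) => // k.
  by case: (cases k) => -> // _.
case: ifP => [|_].
  case: ifP => // c10 c12 _; apply: (cs i1 i0) => // k.
  by case: (cases k) => -> // _.
case: ifP => // c20 c21; apply: (cs i2 i0) => // k.
by case: (cases k) => -> // _.
Qed.

End LabelledTournament.

(* Choice of the labels from the neighbours of one vertex *)
Local Close Scope ring_scope.

Theorem proposition4p1 (R : realType) (V : finType) (e : rel V) :
  #|V| = 9 -> tournament e -> ~ intrinsically_linked R 3 e.
Proof.
move=> V9 eT; have [eirr exor] := eT.
have [x0 _] : exists x0, x0 \in V by apply/card_gt0P; rewrite V9.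
pose A := [set y | e x0 y]%SET; pose B := [set y | e y x0]%SET.
(* The in- and out-neighbours of [x0] exhaust the other eight vertices, so one of the two sets has
   at least four elements. *)
have AB : (8 <= #|A| + #|B|)%N.
  have sub : [set~ x0]%SET \subset (A :|: B)%SET.
    by apply/fintype.subsetP => y; rewrite !inE eq_sym => /exor; case: (e x0 y).
  have := subset_leq_card sub; rewrite cardsC1 V9 => /leq_trans; apply.
  by rewrite cardsU leq_subr.
have [lab [lab_inj lab9 lx0 dom]] : exists lab : V -> nat,
    [/\ injective lab, forall x, (lab x < 9)%N, lab x0 = 0%N &
    (forall x, (1 <= lab x <= 4)%N -> e x0 x) \/ (forall x, (1 <= lab x <= 4)%N -> e x x0)].
  have [x0A x0B] : x0 \notin A /\ x0 \notin B by rewrite !inE eirr.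
  have [A4|A4] := leqP 4 #|A|.
    have [lab [? ? ? labA]] := labelling V9 x0A A4.
    by exists lab; split=> //; left=> x lx; have := labA _ lx; rewrite inE.
  have B4 : (4 <= #|B|)%N by lia.
  have [lab [? ? ? labB]] := labelling V9 x0B B4.
  by exists lab; split=> //; right=> x lx; have := labB _ lx; rewrite inE.
have [f fE] := straight_embedding R lab_inj lab9 eT.
move=> /(_ f)[c [dc cd]]; apply.
exact: (splittable_split lab_inj lab9 eT fE V9 lx0 dom dc cd).
Qed.
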